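(* Let $F$ be a finite set of circles in $\mathbb{R}^2$ (circles of radius zero, i.e. points, allowed), and let $ch_c$ be the closure operator on $F$ given by $ch_c(Y)=\{z\in F:\ \tilde z\subseteq \mathrm{conv}(\bigcup_{y\in Y}\tilde y)\}$ for $Y\subseteq F$. Then the convex geometry $(F,ch_c)$ satisfies the Weak $2\times 3$-Carousel rule: whenever $S\subseteq F$ with $|S|=3$ and $x,y\in ch_c(S)$, there exist $a_1,a_2\in S$ such that $x\in ch_c(\{y,a_1,a_2\})$ or $y\in ch_c(\{x,a_1,a_2\})$.
   Context: For a circle $z$, $\tilde z$ denotes the set of points of $z$, i.e. the closed disc bounded by $z$; $\mathrm{conv}$ is the usual convex hull in $\mathbb{R}^2$. A closure operator $\varphi$ on a set $X$ is an extensive, monotone, idempotent map $2^X\to 2^X$; a convex geometry is a closure system with $\varphi(\emptyset)=\emptyset$ satisfying the anti-exchange property ($Y=\varphi(Y)$, $x,z\notin Y$, $x\ne z$, $z\in\varphi(Y\cup\{x\})$ imply $x\notin\varphi(Y\cup\{z\})$). $(F,ch_c)$ is known to be a convex geometry. *)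

(* Defs.v *)
From mathcomp Require Export all_boot all_order all_algebra finmap.
From mathcomp Require Export boolp classical_sets reals interval_inference convex.

Set Implicit Arguments.
Unset Strict Implicit.
Unset Printing Implicit Defensive.

Import Order.TTheory GRing.Theory Num.Theory.

Local Open Scope classical_set_scope.
Local Open Scope ring_scope.

(* The library norm on 'rV[R]_2 is the sup norm, hence an explicit distance. *)
Definition edist (R : realType) (p q : 'rV[R]_2) : R :=
  Num.sqrt (\sum_(i < 2) (p 0 i - q 0 i) ^+ 2).

(* A circle is a pair (centre, radius); radius 0 gives a point. Two circles
   are equal exactly when their centres and radii are. *)
Definition circle (R : realType) : choiceType := ('rV[R]_2 * {nonneg R})%type.

Definition disc (R : realType) (z : circle R) : set 'rV[R]_2 :=
  [set p | edist p z.1 <= z.2%:num].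

Definition conv_hull (R : realType) (A : set 'rV[R]_2) : set 'rV[R]_2 :=
  smallest (@convex_set R 'rV[R]_2) A.

Definition ch_c (R : realType) (F Y : {fset circle R}) : {fset circle R} :=
  [fset z in F |
    `[< (disc z `<=` conv_hull (\bigcup_(y in [set` Y]) disc y))%classic >]]%fset.

(* Here a1 and a2 are not required to be distinct. *)
Definition weak_carousel_2x3 (T : choiceType) (F : {fset T})
    (phi : {fset T} -> {fset T}) : Prop :=
  forall S : {fset T}, (S `<=` F)%fset -> #|` S|%fset = 3%N ->
  forall x y : T, x \in phi S -> y \in phi S ->
  exists a1 a2 : T, [/\ a1 \in S, a2 \in S &
    x \in phi [fset y; a1; a2]%fset \/ y \in phi [fset x; a1; a2]%fset].

(* Main.v *)
(* The convex hull of finitely many discs is described by support functions: the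
   disc [x] lies in the hull of the discs of [Y] iff in every unit direction some
   disc of [Y] reaches at least as far as [x].  If the rule fails for [x], [y]
   and [S = {z_0, z_1, z_2}], then for every [k] there is a direction [u_k] where
   [x] exceeds [y] and both [z_j] with [j != k], hence where [z_k] dominates [x],
   and a direction [v_k] with the roles of [x] and [y] exchanged.  The directions
   where [x] exceeds [y] form an arc of the unit circle.  Project stereographically
   from an endpoint of this arc: differences of support functions become
   quadratics, and all the [u_k] lie on the same side of all the [v_k].  If [u_k]
   is between [u_i] and [u_j], the quadratic of [x - z_k] has signs [+], [-],
   [+], [-] at [u_i], [u_k], [u_j], [v_k], which is impossible. *)
Require Import Defs.
From mathcomp Require Import all_boot all_order all_algebra finmap.
From mathcomp Require Import boolp classical_sets reals interval_inference convex.
From mathcomp Require Import topology normedtype derive realfun ring lra.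

Import Order.TTheory GRing.Theory Num.Theory.
Import numFieldNormedType.Exports.

Local Open Scope classical_set_scope.
Local Open Scope ring_scope.

(** * Real inequalities: signs of quadratics and a first-order condition *)

Section Quadratic.
Context {R : realType}.
Implicit Types a b c s t : R.

Lemma quadratic_no_alternation a b c s1 s2 s3 t
    (q := fun s => a * s ^+ 2 + b * s + c) :
    s1 <= s2 -> s2 <= s3 -> t < s1 \/ s3 < t ->
  0 < q s1 -> q s2 <= 0 -> 0 < q s3 -> 0 <= q t.
Proof.
move=> s12 s23 st q1 q2 q3; rewrite leNgt; apply/negP => qt.
have {}s12 : s1 < s2.
  by rewrite lt_neqAle s12 andbT; apply: contraTneq q1 => ->; rewrite -leNgt.
have {}s23 : s2 < s3.
  by rewrite lt_neqAle s23 andbT; apply: contraTneq q3 => <-; rewrite -leNgt.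
(* The third divided difference of a quadratic vanishes. *)
have : q s1 * ((s3 - s2) * ((t - s2) * (t - s3)))
     - q s2 * ((s3 - s1) * ((t - s1) * (t - s3)))
     + q s3 * ((s2 - s1) * ((t - s1) * (t - s2)))
     = q t * ((s2 - s1) * (s3 - s1) * (s3 - s2)) by rewrite /q; ring.
have h1 : 0 < s2 - s1 by lra.
have h2 : 0 < s3 - s2 by lra.
have h3 : 0 < s3 - s1 by lra.
have : q t * ((s2 - s1) * (s3 - s1) * (s3 - s2)) < 0.
  by rewrite pmulr_llt0 // !mulr_gt0.
have : 0 < (t - s2) * (t - s3) by case: st => ?; nra.
have : 0 < (t - s1) * (t - s3) by case: st => ?; nra.
have : 0 < (t - s1) * (t - s2) by case: st => ?; nra.
move: (q s1) (q s2) (q s3) (q t) q1 q2 q3.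
move=> e1 e2 e3 e4 q1 q2 q3 p12 p13 p23 lt0 E.
have : 0 < e1 * ((s3 - s2) * ((t - s2) * (t - s3))).
  by rewrite !(mulr_gt0 q1) // mulr_gt0.
have : 0 < e3 * ((s2 - s1) * ((t - s1) * (t - s2))).
  by rewrite !(mulr_gt0 q3) // mulr_gt0.
have : e2 * ((s3 - s1) * ((t - s1) * (t - s3))) <= 0.
  by rewrite mulr_le0_ge0 // ltW // mulr_gt0.
lra.
Qed.

(* [D + rho * N] is, up to the factor [N], minus the derivative at [e = 0] of
   [sqrt (N ^+ 2 - 2 * e * D + e ^+ 2 * W) - e * rho]. *)
Lemma sqrt_first_order (N D W rho : R) : 0 < N -> 0 <= W ->
  (forall e, 0 <= e <= 1 ->
    N + e * rho <= Num.sqrt (N ^+ 2 - 2 * e * D + e ^+ 2 * W)) ->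
  D + rho * N <= 0.
Proof.
move=> N0 W0 H; rewrite leNgt; apply/negP => k0.
pose r := `|rho| + 1; have r0 : 0 < r by rewrite /r ltr_wpDl.
(* The second bound makes [e * W] smaller than [D + rho * N]; the third keeps [N + e * rho]
   positive, so that squaring is legitimate. *)
pose e := Num.min 1 (Num.min ((D + rho * N) / (W + 1)) (N / r)).
have W1 : 0 < W + 1 by lra.
have e0 : 0 < e by rewrite !lt_min ltr01 !divr_gt0.
have e1 : e <= 1 by rewrite ge_min lexx.
have ek : e * (W + 1) <= D + rho * N.
  by rewrite -ler_pdivlMr // !ge_min lexx orbT.
have eN : e * r <= N by rewrite -ler_pdivlMr // !ge_min lexx !orbT.
have pos : 0 < N + e * rho.
  have : 1 - r <= rho.
    by rewrite /r; have := ler_norm (- rho); rewrite normrN; lra.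
  by nra.
have := H e; rewrite e1 ltW // => /(_ isT) le_sqrt.
have sq_gt0 : 0 < N ^+ 2 - 2 * e * D + e ^+ 2 * W.
  by rewrite -sqrtr_gt0 (lt_le_trans pos).
move: le_sqrt; rewrite -(@ler_pXn2r _ 2) ?nnegrE ?sqrtr_ge0 ?(ltW pos) //.
rewrite sqr_sqrtr ?(ltW sq_gt0) // => sq.
have : e * (2 * (D + rho * N)) <= e * (e * W) by nra.
rewrite ler_pM2l //; nra.
Qed.

End Quadratic.

Lemma ord2P (i : 'I_2) : i = 0 \/ i = 1.
Proof. by case: i => [[|[|//]] ?]; [left|right]; apply: val_inj. Qed.

(** * Plane geometry: support functions and stereographic projection *)

Section Plane.
Context {R : realType}.
Implicit Types (p q u v w : 'rV[R]_2) (z : circle R).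

Definition dotp p q : R := p 0 0 * q 0 0 + p 0 1 * q 0 1.

Definition rot90 p : 'rV[R]_2 := \row_i (if i == 0 then - p 0 1 else p 0 0).

(** This is the support function of the disc at unit vectors [u] only; otherwise the radius would be
    scaled by the length of [u]. *)
Definition supportf z u : R := dotp z.1 u + z.2%:num.

Lemma sum_ord2 (f : 'I_2 -> R) : \sum_(i < 2) f i = f 0 + f 1.
Proof.
by rewrite big_ord_recr big_ord1 /=; congr (f _ + f _); apply: val_inj.
Qed.

Lemma edistE p q : Defs.edist p q = Num.sqrt (dotp (p - q) (p - q)).
Proof. by rewrite /Defs.edist sum_ord2 /dotp !mxE. Qed.

Lemma dotpDl p q u : dotp (p + q) u = dotp p u + dotp q u.
Proof. by rewrite /dotp !mxE; ring. Qed.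

Lemma dotpZl k p u : dotp (k *: p) u = k * dotp p u.
Proof. by rewrite /dotp !mxE; ring. Qed.

Lemma dotpBl p q u : dotp (p - q) u = dotp p u - dotp q u.
Proof. by rewrite /dotp !mxE; ring. Qed.

Lemma dotpC p q : dotp p q = dotp q p.
Proof. by rewrite /dotp; ring. Qed.

Lemma dotp_ge0 p : 0 <= dotp p p.
Proof. by rewrite /dotp -!expr2 addr_ge0 ?sqr_ge0. Qed.

Lemma dotp_rot90 p q :
  dotp p q ^+ 2 + dotp p (rot90 q) ^+ 2 = dotp p p * dotp q q.
Proof. by rewrite /dotp !mxE /=; ring. Qed.

Lemma dotp_sqr_le p q : dotp p q ^+ 2 <= dotp p p * dotp q q.
Proof. by rewrite -dotp_rot90 lerDl sqr_ge0. Qed.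

Lemma disc_dotp_le z p u : dotp u u = 1 -> disc z p -> dotp p u <= supportf z u.
Proof.
move=> u1; rewrite /disc /= edistE => h.
have : dotp (p - z.1) u <= z.2%:num.
  apply: le_trans h; apply: le_trans (ler_norm _) _.
  rewrite -sqrtr_sqr ler_sqrt ?dotp_ge0 //.
  by have := dotp_sqr_le (p - z.1) u; rewrite u1 mulr1.
by rewrite dotpBl /supportf lerBlDl.
Qed.

Lemma disc_support_point z u : dotp u u = 1 -> disc z (z.1 + z.2%:num *: u).
Proof.
move=> u1; rewrite /disc /= edistE addrAC subrr add0r.
by rewrite dotpZl dotpC dotpZl u1 mulr1 -expr2 sqrtr_sqr ger0_norm.
Qed.

(** Here [s] is the stereographic coordinate of [u] seen from [w]: if [u] has coordinates [a], [b]
    along [w] and [rot90 w], then [s = b / (1 - a)], [(1 + s ^+ 2) * a = s ^+ 2 - 1] and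
    [(1 + s ^+ 2) * b = 2 * s]. The positive factor [1 + s ^+ 2] preserves signs. *)
Lemma stereographic w u : dotp w w = 1 -> dotp u u = 1 -> u <> w ->
  exists s, forall p k, (1 + s ^+ 2) * (dotp p u + k) =
    (dotp p w + k) * s ^+ 2 + (2 * dotp p (rot90 w)) * s + (k - dotp p w).
Proof.
move=> w1 u1 uw; pose a := dotp u w; pose b := dotp u (rot90 w).
have ab : b ^+ 2 = 1 - a ^+ 2.
  by have := dotp_rot90 u w; rewrite w1 u1 mulr1 -/a -/b; lra.
have uE p : dotp p u = a * dotp p w + b * dotp p (rot90 w).
  by rewrite -[LHS]mul1r -w1 /a /b /dotp !mxE /=; ring.
have a1 : 1 - a != 0.
  apply/eqP => h; apply: uw.
  have aE : a = 1 by lra.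
  have b0 : b = 0 by apply/eqP; rewrite -sqrf_eq0 ab aE expr1n subrr.
  apply/rowP => i; have := uE (delta_mx 0 i); rewrite aE b0 /dotp !mxE /=.
  by have [->|->] := ord2P i; rewrite /=; lra.
exists (b / (1 - a)) => p k; rewrite uE.
have -> : (b / (1 - a)) ^+ 2 = (1 + a) / (1 - a).
  by rewrite expr_div_n ab; field.
by field.
Qed.

End Plane.

(** * The carousel argument for support functions *)

Section Carousel.
Context {R : realType}.
Implicit Types (p q u v w d : 'rV[R]_2) (x y z : circle R).

(** By Cauchy-Schwarz, [t ^+ 2 < dotp d d], so the line [dotp d = t] meets the unit circle; [w] is
    the foot of the perpendicular from the origin plus half the chord. *)
Lemma unit_vector_on_line d (t : R) u v : dotp u u = 1 -> dotp v v = 1 ->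
  dotp d v < t < dotp d u -> exists2 w, dotp w w = 1 & dotp d w = t.
Proof.
move=> u1 v1 /andP[tv tu]; pose D := dotp d d.
have tD : t ^+ 2 < D.
  have := dotp_sqr_le d u; have := dotp_sqr_le d v; rewrite u1 v1 mulr1 -/D.
  move: (dotp d u) (dotp d v) tu tv => a b ta bt hb ha.
  have [t0|t0] := leP 0 t.
    by apply: lt_le_trans ha; rewrite ltr_pXn2r ?nnegrE //; lra.
  apply: lt_le_trans hb; rewrite -sqrrN -[b ^+ 2]sqrrN.
  by rewrite ltr_pXn2r ?nnegrE //; lra.
have D0 : 0 < D by apply: le_lt_trans tD; exact: sqr_ge0.
pose r := Num.sqrt (D - t ^+ 2).
have rE : r ^+ 2 = D - t ^+ 2 by rewrite sqr_sqrtr // subr_ge0 ltW.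
have Dn0 : D != 0 by rewrite gt_eqF.
exists ((t / D) *: d + (r / D) *: rot90 d).
  rewrite dotpDl ![dotp _ (_ + _)]dotpC !dotpDl !dotpZl.
  rewrite ![dotp _ (_ *: _)]dotpC !dotpZl.
  have -> : dotp (rot90 d) (rot90 d) = D by rewrite /D /dotp !mxE /=; ring.
  rewrite [dotp (rot90 d) d]dotpC.
  have -> : dotp d (rot90 d) = 0 by rewrite /dotp !mxE /=; ring.
  rewrite -/D.
  transitivity ((t ^+ 2 + r ^+ 2) / D); first by field.
  by rewrite rE; field.
rewrite dotpC dotpDl !dotpZl [dotp (rot90 d) d]dotpC.
have -> : dotp d (rot90 d) = 0 by rewrite /dotp !mxE /=; ring.
by rewrite -/D; field.
Qed.

Lemma median3 (s : 'I_3 -> R) :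
  exists i k j, [/\ i != k, j != k, s i <= s k & s k <= s j].
Proof.
pose i0 : 'I_3 := 0; pose i1 : 'I_3 := 1; pose i2 : 'I_3 := 2%:R.
have [h01|h01] := leP (s i0) (s i1); have [h12|h12] := leP (s i1) (s i2);
  have [h02|h02] := leP (s i0) (s i2).
- by exists i0, i1, i2.
- by exists i0, i1, i2.
- by exists i0, i2, i1; split => //; exact: ltW.
- by exists i2, i0, i1; split => //; exact: ltW.
- by exists i1, i0, i2; split => //; exact: ltW.
- by exists i1, i2, i0; split => //; exact: ltW.
- by exists i2, i1, i0; split => //; exact: ltW.
- by exists i2, i1, i0; split => //; exact: ltW.
Qed.

Lemma support_no_double_carousel x y (z : 'I_3 -> circle R)
    (u v : 'I_3 -> 'rV[R]_2) :
    (forall k, dotp (u k) (u k) = 1) -> (forall k, dotp (v k) (v k) = 1) ->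
    (forall k, supportf y (u k) < supportf x (u k) <= supportf (z k) (u k)) ->
    (forall j k, j != k -> supportf (z j) (u k) < supportf x (u k)) ->
    (forall k, supportf x (v k) < supportf y (v k) <= supportf (z k) (v k)) ->
  False.
Proof.
move=> u1 v1 xyu zxu yxv.
(* The difference [supportf x q - supportf y q] equals [dotp d q - t], so [x] and [y] tie exactly on
   the line [dotp d = t]. *)
pose d := x.1 - y.1; pose t := y.2%:num - x.2%:num.
have du k : t < dotp d (u k).
  by have /andP[+ _] := xyu k; rewrite /supportf /t dotpBl; lra.
have dv k : dotp d (v k) < t.
  by have /andP[+ _] := yxv k; rewrite /supportf /t dotpBl; lra.
have [w w1 dw] : exists2 w, dotp w w = 1 & dotp d w = t.
  by apply: (unit_vector_on_line d t (u 0) (v 0)) => //; rewrite du dv.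
have uw k : u k <> w by move=> E; have := du k; rewrite E dw ltxx.
have vw k : v k <> w by move=> E; have := dv k; rewrite E dw ltxx.
have /choice[s sE] k := stereographic w (u k) w1 (u1 k) (uw k).
have [i [k [j [ik jk sik skj]]]] := median3 s.
have [r rE] := stereographic w (v k) w1 (v1 k) (vw k).
have pos (e : R) : 0 < 1 + e ^+ 2 by rewrite ltr_wpDr ?sqr_ge0.
(* [w] lies on the line [dotp d = t], so the leading coefficients vanish. *)
have su l : 0 < 2 * dotp d (rot90 w) * s l + (- t - dotp d w).
  have : 0 < (1 + s l ^+ 2) * (dotp d (u l) - t) by rewrite mulr_gt0 ?subr_gt0.
  by rewrite sE dw subrr mul0r add0r.
have rv : 2 * dotp d (rot90 w) * r + (- t - dotp d w) < 0.
  have : (1 + r ^+ 2) * (dotp d (v k) - t) < 0 by rewrite pmulr_rlt0 ?subr_lt0.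
  by rewrite rE dw subrr mul0r add0r.
(* An affine function of the parameter is positive at every [s l] and negative at [r]; the sign of
   its slope [A] decides on which side [r] lies. *)
have side : r < s i \/ s j < r.
  have := su i; have := su j; move: rv; set A := 2 * _; set B := _ - _.
  move=> h1 h2 h3; have [A0|A0] := leP 0 A; [left|right].
    by rewrite ltNge; apply/negP => ?; nra.
  by rewrite ltNge; apply/negP => ?; nra.
pose p := x.1 - (z k).1; pose c := x.2%:num - (z k).2%:num.
have pc q : supportf x q - supportf (z k) q = dotp p q + c.
  by rewrite /supportf /p /c dotpBl; ring.
have := quadratic_no_alternation _ _ _ _ _ _ _ sik skj side.
move=> /(_ (dotp p w + c) (2 * dotp p (rot90 w)) (c - dotp p w)).
rewrite -!sE -rE -!pc !pmulr_rgt0 // pmulr_rle0 // pmulr_rge0 //.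
rewrite !subr_gt0 subr_le0 subr_ge0 zxu 1?eq_sym // zxu 1?eq_sym //.
have /andP[_ ->] := xyu k => /(_ isT isT isT).
by have /andP[h1 h2] := yxv k; rewrite leNgt (lt_le_trans h1 h2).
Qed.

End Carousel.

(** * Convex combinations and hulls *)

Section ConvexHull.
Context {R : realType}.

Lemma convex_comb (A : set 'rV[R]_2) (a : R) p q :
  @convex_set R 'rV[R]_2 A -> 0 <= a <= 1 -> A p -> A q ->
  A (a *: p + (1 - a) *: q).
Proof.
move=> cA a01 Ap Aq.
have := cA p q (Itv01 (andP a01).1 (andP a01).2).
by rewrite !in_setE => /(_ Ap Aq).
Qed.

(** Induction on [n]: the tail is renormalised by its total weight [1 - l ord0], unless that weight
    is zero and the tail vanishes. *)
Lemma convex_sum (A : set 'rV[R]_2) n (l : 'I_n -> R) (p : 'I_n -> 'rV[R]_2) :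
  @convex_set R 'rV[R]_2 A -> (forall i, 0 <= l i) -> \sum_i l i = 1 ->
  (forall i, A (p i)) -> A (\sum_i l i *: p i).
Proof.
move=> cA; elim: n l p => [|n IH] l p l0 l1 Ap.
  by move: l1; rewrite big_ord0 => /esym/eqP; rewrite oner_eq0.
have S0 : 0 <= \sum_(i < n) l (lift ord0 i) by apply: sumr_ge0.
move: l1; rewrite !big_ord_recl => l1.
have [S|S] := eqVneq (\sum_(i < n) l (lift ord0 i)) 0.
  rewrite [X in _ + X]big1 => [|i _].
    by rewrite addr0 -[l ord0]addr0 -S l1 scale1r.
  have : forall i, true -> 0 <= l (lift ord0 i) by move=> *; exact: l0.
  by move=> /psumr_eq0P/(_ S i isT) ->; rewrite scale0r.
set T := \sum_(i < n) l _ in S0 l1 S.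
have TE : 1 - l ord0 = T by rewrite -l1 addrAC subrr add0r.
have -> : \sum_(i < n) l (lift ord0 i) *: p (lift ord0 i) =
    (1 - l ord0) *: \sum_(i < n) (l (lift ord0 i) / T) *: p (lift ord0 i).
  rewrite scaler_sumr; apply: eq_bigr => i _.
  by rewrite scalerA TE mulrCA divff // mulr1.
apply: convex_comb => //; first by rewrite l0 -subr_ge0 TE.
apply: IH => // [i|]; first by rewrite divr_ge0.
by rewrite -mulr_suml divff.
Qed.

Lemma conv_hull_convex (A : set 'rV[R]_2) :
  @convex_set R 'rV[R]_2 (conv_hull A).
Proof.
move=> p q l; rewrite !in_setE => Ap Aq B [cB AB].
by have := cB p q l; rewrite !in_setE; apply; [apply: Ap|apply: Aq].
Qed.

(** An open half-plane is convex. *)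
Lemma conv_hull_dotp_lt (A : set 'rV[R]_2) u (m : R) :
  (forall q, A q -> dotp q u < m) -> forall p, conv_hull A p -> dotp p u < m.
Proof.
move=> Am; apply: (@smallest_sub _ _ _ [set q | dotp q u < m]) => // a b l.
rewrite !in_setE => ha hb.
suff : dotp (l%:num *: a + (1 - l%:num) *: b) u < m by [].
have {}ha : dotp a u < m by [].
have {}hb : dotp b u < m by [].
have l0 : 0 <= l%:num by [].
have l1 : l%:num <= 1 by [].
rewrite dotpDl !dotpZl.
move: (l%:num) (dotp a u) (dotp b u) l0 l1 ha hb => e a' b' e0 e1 ha hb.
have [->|en0] := eqVneq e 0; first by lra.
have {}e0 : 0 < e by rewrite lt_neqAle eq_sym en0.
by nra.
Qed.

End ConvexHull.

(** * Separating a point from the hull of finitely many discs *)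

Section Separation.
Context {R : realType}.

Definition simplex n : set 'rV[R]_n :=
  [set l | (forall i, 0 <= l 0 i) /\ \sum_i l 0 i = 1].

Lemma lincomb_continuous n (c : 'I_n -> R) :
  continuous (fun l : 'rV[R]_n => \sum_i l 0 i * c i).
Proof.
elim: (index_enum _) => [|i s IH] l.
  by rewrite (_ : (fun _ => _) = fun=> 0); [exact: cst_continuous|];
    apply/funext => ?; rewrite big_nil.
rewrite (_ : (fun _ => _) =
    fun l : 'rV[R]_n => l 0 i * c i + \sum_(j <- s) l 0 j * c j).
  exact: (cvgD (cvgM (@coord_continuous R 1 n 0 i l) (cvg_cst (c i))) (IH l)).
by apply/funext => ?; rewrite big_cons.
Qed.

Lemma simplex_compact n : compact (simplex n).
Proof.
have cbox : compact [set l : 'rV[R]_n | forall i, `[0, 1]%classic (l 0 i)].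
  apply: (@rV_compact R n (fun=> `[0, 1]%classic)) => _.
  exact: segment_compact.
(* The factor [1] gives the sum the shape treated in [lincomb_continuous]. *)
have csum : closed [set l : 'rV[R]_n | \sum_i l 0 i * 1 = 1].
  apply: (@preimage_closed _ _ _ [set r : R | r = 1]); last exact: closed_eq.
  by move=> l _; exact: (lincomb_continuous n (fun=> 1)).
have := compact_closedI cbox csum; congr (compact _).
apply/seteqP; split => l /=; under eq_bigr do rewrite mulr1.
  move=> [l01 l1]; split => // i.
  by have := l01 i; rewrite in_itv /= => /andP[].
move=> [l0 l1]; split => // i; rewrite in_itv /= l0 /= -l1.
by rewrite (bigD1 i) //= lerDl sumr_ge0.
Qed.

(** Writing [p = c + r *: e] with [e] in the unit disc exhibits [p] as the average, with weights
    [l], of the points [(z i).1 + (z i).2%:num *: e] of the discs. *)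
Lemma disc_conv_hull n (z : 'I_n -> circle R) (l : 'rV[R]_n) p :
  simplex n l ->
  Defs.edist p (\sum_i l 0 i *: (z i).1) <= \sum_i l 0 i * (z i).2%:num ->
  conv_hull (\bigcup_i disc (z i)) p.
Proof.
move=> [l0 l1]; set c := \sum_i _; set r := (X in _ <= X) => pcr.
have [e e1 pE] : exists2 e : 'rV[R]_2, dotp e e <= 1 & p = c + r *: e.
  rewrite -/c edistE in pcr.
  have r0 : 0 <= r by apply: le_trans pcr; exact: sqrtr_ge0.
  have {}pcr : dotp (p - c) (p - c) <= r ^+ 2.
    by rewrite -ler_sqrt ?sqr_ge0 // sqrtr_sqr ger0_norm.
  have [rz|rn0] := eqVneq r 0.
    exists 0; first by rewrite /dotp !mxE !mul0r addr0 ler01.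
    rewrite scaler0 addr0; apply/eqP; rewrite -subr_eq0; apply/eqP/rowP => i.
    move: pcr; rewrite rz expr0n /= /dotp -!expr2.
    set a := p - c; have := sqr_ge0 (a 0 0); have := sqr_ge0 (a 0 1).
    move=> h1 h0 h.
    have a0 : a 0 0 = 0 by apply/eqP; rewrite -sqrf_eq0; apply/eqP; lra.
    have a1 : a 0 1 = 0 by apply/eqP; rewrite -sqrf_eq0; apply/eqP; lra.
    by have [->|->] := ord2P i; rewrite ?a0 ?a1 mxE.
  exists (r^-1 *: (p - c)).
    rewrite dotpZl dotpC dotpZl mulrA -expr2 exprVn mulrC.
    by rewrite ler_pdivrMr ?mul1r // exprn_gt0 // lt_neqAle eq_sym rn0.
  by rewrite scalerA divff // scale1r addrC subrK.
have -> : p = \sum_i l 0 i *: ((z i).1 + (z i).2%:num *: e).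
  rewrite pE /c /r scaler_suml -big_split /=; apply: eq_bigr => i _.
  by rewrite scalerDr scalerA.
apply: convex_sum => //; first exact: conv_hull_convex.
move=> i; apply: sub_gen_smallest; exists i => //.
rewrite /disc /= edistE addrAC subrr add0r dotpZl dotpC dotpZl mulrA -expr2.
rewrite -[leRHS]ger0_norm // -sqrtr_sqr ler_sqrt ?sqr_ge0 //.
by rewrite ler_piMr ?sqr_ge0.
Qed.

(** Minimise over the simplex the distance from [p] to the averaged centre minus the averaged
    radius. The minimum is positive by [disc_conv_hull], and the direction from the optimal centre
    to [p] separates, by the first-order condition towards each vertex. *)
Lemma conv_hull_discs_separation n (z : 'I_n.+1 -> circle R) p :
  ~ conv_hull (\bigcup_i disc (z i)) p ->
  exists2 u, dotp u u = 1 & forall i, supportf (z i) u < dotp p u.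
Proof.
move=> pn.
pose c (l : 'rV[R]_n.+1) := \sum_i l 0 i *: (z i).1.
pose r (l : 'rV[R]_n.+1) := \sum_i l 0 i * (z i).2%:num.
pose phi l := Defs.edist p (c l) - r l.
have phi_cont : continuous phi.
  have -> : phi = fun l => Num.sqrt (\sum_(k < 2)
      (p 0 k - \sum_i l 0 i * (z i).1 0 k) ^+ 2) - r l.
    apply/funext => l; rewrite /phi /Defs.edist; congr (Num.sqrt _ - _).
    apply: eq_bigr => k _; rewrite /c summxE.
    by under [in LHS]eq_bigr do rewrite mxE.
  under eq_fun do rewrite sum_ord2.
  have cont k : continuous (fun l : 'rV[R]_n.+1 =>
      (p 0 k - \sum_i l 0 i * (z i).1 0 k) ^+ 2).
    move=> l; have h := [elaborate cvgB (cvg_cst (p 0 k))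
      (lincomb_continuous n.+1 (fun i => (z i).1 0 k) l)].
    exact: (cvgM h h).
  move=> l; have h := [elaborate cvgD (cont 0 l) (cont 1 l)].
  have h' := [elaborate continuous_cvg _ (@sqrt_continuous R _) h].
  exact: (cvgB h' (lincomb_continuous n.+1 (fun i => (z i).2%:num) l)).
have simplex0 : simplex n.+1 !=set0.
  exists (delta_mx 0 0); split => [i|]; first by rewrite mxE ler0n.
  rewrite (bigD1 ord0) //= mxE !eqxx big1 ?addr0 // => i i0.
  by rewrite mxE (negbTE i0) andbF.
have [l [l0 l1] lmin] : exists2 l, simplex n.+1 l &
    forall l', simplex n.+1 l' -> phi l <= phi l'.
  have [l + lmin] := EVT_min_rV simplex0 (@simplex_compact n.+1)
    (continuous_subspaceT phi_cont).
  by rewrite in_setE => ls; exists l => // l' ?; apply: lmin; rewrite in_setE.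
have phi0 : 0 < phi l.
  rewrite ltNge; apply/negP; rewrite subr_le0 => h.
  by apply: pn; exact: disc_conv_hull h.
pose q := p - c l; pose N := Num.sqrt (dotp q q).
have NE : N ^+ 2 = dotp q q by rewrite sqr_sqrtr ?dotp_ge0.
have r0 : 0 <= r l by apply: sumr_ge0 => i _; rewrite mulr_ge0.
have NrE : phi l = N - r l by rewrite /phi edistE.
have N0 : 0 < N by lra.
exists (N^-1 *: q).
  by rewrite dotpZl dotpC dotpZl -NE; field; rewrite gt_eqF.
move=> i; pose w := (z i).1 - c l; pose rho := (z i).2%:num - r l.
have step : dotp q w + rho * N <= 0.
  apply: (sqrt_first_order _ _ (dotp w w)) => //; first exact: dotp_ge0.
  move=> e /andP[e0 e1].
  pose l' := (1 - e) *: l + e *: delta_mx 0 i.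
  (* A general module [V] covers the centres and, with [R^o], the radii and the total weight. *)
  have linE (V : lmodType R) (f : 'I_n.+1 -> V) :
      \sum_j l' 0 j *: f j = (1 - e) *: (\sum_j l 0 j *: f j) + e *: f i.
    rewrite scaler_sumr.
    have -> : e *: f i = \sum_j (e * (delta_mx 0 i : 'rV[R]_n.+1) 0 j) *: f j.
      rewrite (bigD1 i) //= big1 ?addr0 ?mxE ?eqxx ?mulr1 // => j ji.
      by rewrite mxE (negbTE ji) andbF mulr0 scale0r.
    rewrite -big_split /=; apply: eq_bigr => j _.
    by rewrite !mxE [LHS]scalerDl scalerA.
  have ls' : simplex n.+1 l'.
    split => [j|]; first by rewrite !mxE addr_ge0 ?mulr_ge0 ?ler0n // subr_ge0.
    have : \sum_j l' 0 j * 1 = (1 - e) * (\sum_j l 0 j * 1) + e * 1.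
      exact: (linE R^o (fun=> 1)).
    by rewrite -!mulr_suml l1 !mulr1 subrK.
  have cE : c l' = (1 - e) *: c l + e *: (z i).1 by exact: linE.
  have rE : r l' = (1 - e) * r l + e * (z i).2%:num.
    exact: (linE R^o (fun j => (z j).2%:num)).
  have := lmin _ ls'; rewrite NrE /phi rE edistE.
  have -> : dotp (p - c l') (p - c l') =
      N ^+ 2 - 2 * e * dotp q w + e ^+ 2 * dotp w w.
    by rewrite cE NE /q /w /dotp !mxE; ring.
  by rewrite /rho; lra.
have uE d : dotp d (N^-1 *: q) = N^-1 * dotp d q by rewrite dotpC dotpZl dotpC.
rewrite /supportf !uE.
rewrite -(ltr_pM2l N0) mulrDr !mulrA divff ?gt_eqF // !mul1r.
(* After scaling by [N], [step] bounds the left side by [dotp (c l) q + r l * N], and [r l < N]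
   gives strictness. *)
have cN : dotp p q = dotp (c l) q + N ^+ 2.
  by rewrite NE -dotpDl /q [_ + (p - _)]addrC subrK.
have : dotp q w = dotp (z i).1 q - dotp (c l) q by rewrite dotpC dotpBl.
move: step phi0; rewrite NrE /rho cN => h1 h2 h3; nra.
Qed.

End Separation.

Lemma in_fset3 (T : choiceType) (a b c t : T) :
  (t \in [fset a; b; c]%fset) = [|| t == a, t == b | t == c].
Proof. by rewrite !inE orbA. Qed.

(** * The closure operator through support functions *)

Section CircleClosure.
Context {R : realType}.
Implicit Types (F Y S : {fset circle R}) (x y : circle R).

Lemma in_ch_c F Y x : (x \in ch_c F Y) <->
  x \in F /\ disc x `<=` conv_hull (\bigcup_(y in [set` Y]) disc y).
Proof.
rewrite /ch_c !inE /=; split => [/andP[-> /asboolP]//|[-> h]].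
exact/asboolP.
Qed.

(** Otherwise the hull would lie in an open half-plane that misses the extreme point of [x] in
    direction [u]. *)
Lemma ch_c_supportf F Y x u : x \in ch_c F Y -> dotp u u = 1 ->
  exists2 y, y \in Y & supportf x u <= supportf y u.
Proof.
move=> /in_ch_c[_ xY] u1; apply: contrapT => nY.
have := xY _ (disc_support_point x u u1).
move=> /(conv_hull_dotp_lt _ u (supportf x u)) h.
suff : dotp (x.1 + x.2%:num *: u) u < supportf x u.
  by rewrite /supportf dotpDl dotpZl u1 mulr1 ltxx.
apply: h => q [y /= yY yq]; apply: le_lt_trans (disc_dotp_le _ _ _ u1 yq) _.
by rewrite ltNge; apply/negP => le; apply: nY; exists y.
Qed.

Lemma notin_ch_c_supportf F Y x : x \in F -> x \notin ch_c F Y ->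
  exists2 u, dotp u u = 1 & forall y, y \in Y -> supportf y u < supportf x u.
Proof.
move=> xF /negP xY.
have [p xp pY] : exists2 p, disc x p &
    ~ conv_hull (\bigcup_(y in [set` Y]) disc y) p.
  apply: contrapT => H; apply: xY; apply/in_ch_c; split => // p xp.
  by apply: contrapT => pY; apply: H; exists p.
(* Separation requires a nonempty family; for empty [Y] any unit vector serves. *)
have [Y0|] := posnP (size Y).
  exists (delta_mx 0 0); first by rewrite /dotp !mxE /= mul0r addr0 mulr1.
  by move=> y; rewrite (cardfs0_eq Y0) inE.
move=> /prednK sY; pose z (i : 'I_(size Y).-1.+1) := nth x Y i.
have [|u u1 zu] := conv_hull_discs_separation _ z p.
  apply: contra_not pY => zp; move: p zp {xp}.
  apply: smallest_sub; first exact: conv_hull_convex.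
  move=> q [i _ iq]; apply: sub_gen_smallest; exists (z i) => //=.
  by apply: mem_nth; have := ltn_ord i; rewrite [X in (_ < X)%N]sY.
exists u => // y yY; apply: lt_le_trans (disc_dotp_le _ _ _ u1 xp).
have iY : (index y Y < (size Y).-1.+1)%N by rewrite sY index_mem.
by have := zu (Ordinal iY); rewrite /z /= nth_index.
Qed.

(** Separate [x] from [y] and the two circles of [S] other than [z k]. Some circle of [S] still
    reaches as far as [x] in that direction, and only [z k] is left. *)
Lemma ch_c_carousel_direction F S (z : 'I_3 -> circle R) x y :
    (forall a, (a \in S) = [exists k, a == z k]) -> x \in ch_c F S ->
    (forall a b, a \in S -> b \in S -> x \notin ch_c F [fset y; a; b]%fset) ->
  forall k, exists u, [/\ dotp u u = 1,
    supportf y u < supportf x u <= supportf (z k) u &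
    forall j, j != k -> supportf (z j) u < supportf x u].
Proof.
move=> zS xS xN k.
have zin i : z i \in S by rewrite zS; apply/existsP; exists i.
have /in_ch_c[xF _] := xS.
(* Addition in ['I_3] is modulo 3, so [k + 1] and [k + 2%:R] are the two indices other than [k]. *)
have [u u1 lt_u] := notin_ch_c_supportf _ _ _ xF
  (xN _ _ (zin (k + 1)) (zin (k + 2%:R))).
have zu j : j != k -> supportf (z j) u < supportf x u.
  move=> jk; apply: lt_u; have : j = k + 1 \/ j = k + 2%:R.
    by case: k j jk {zin} => [[|[|[|//]]] ?] [[|[|[|//]]] ?] //= _;
      (left; exact: val_inj) || (right; exact: val_inj).
  by move=> [->|->]; rewrite in_fset3 eqxx ?orbT.
exists u; split => //; rewrite lt_u ?in_fset3 ?eqxx //=.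
have [a + xa] := ch_c_supportf _ _ _ _ xS u1.
rewrite zS => /existsP[j /eqP aE]; rewrite {}aE in xa.
by have [<-//|/zu] := eqVneq j k; rewrite ltNge xa.
Qed.

End CircleClosure.

Theorem theorem5p1 (R : realType) (F : {fset circle R}) :
  weak_carousel_2x3 F (ch_c F).
Proof.
move=> S _ S3 x y xS yS; apply: contrapT => none.
pose z (k : 'I_3) := nth x S k.
have zS a : (a \in S) = [exists k, a == z k].
  apply/idP/existsP => [aS|[k /eqP ->]]; last by rewrite mem_nth ?S3.
  have iS : (index a S < 3)%N by rewrite -S3 index_mem.
  by exists (Ordinal iS); rewrite /z /= nth_index.
have /choice[u uP] : forall k, exists u, [/\ dotp u u = 1,
    supportf y u < supportf x u <= supportf (z k) u &
    forall j, j != k -> supportf (z j) u < supportf x u].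
  apply: (ch_c_carousel_direction F S) => // a b aS bS.
  by apply/negP => h; apply: none; exists a, b; split => //; left.
have /choice[v vP] : forall k, exists v, [/\ dotp v v = 1,
    supportf x v < supportf y v <= supportf (z k) v &
    forall j, j != k -> supportf (z j) v < supportf y v].
  apply: (ch_c_carousel_direction F S) => // a b aS bS.
  by apply/negP => h; apply: none; exists a, b; split => //; right.
apply: (support_no_double_carousel x y z u v) => [k|k|k|j k jk|k].
- by have [] := uP k.
- by have [] := vP k.
- by have [] := uP k.
- by have [_ _] := uP k; exact.
- by have [] := vP k.
Qed.
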